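(* Let $X,Y$ be pointed metric spaces. If $1\le s_2\le s_1\le\infty$; $0<p_j\le s_j\le\infty$ for $j=1,2$; $0<p_1\le p_2$; $0<r_1\le r_2$; $r_j\le p_j$ for $j=1,2$; and $\frac1{r_1}-\frac1{r_2}\le\frac1{p_1}-\frac1{p_2}$, then $$\Pi^L_{(\mathfrak{m}^L(s_1;p_1),r_1)}(X,Y)\subset\Pi^L_{(\mathfrak{m}^L(s_2;p_2),r_2)}(X,Y).$$ Moreover $\pi^L_{(\mathfrak{m}^L(s_2;p_2),r_2)}(S)\le\pi^L_{(\mathfrak{m}^L(s_1;p_1),r_1)}(S)$ for every $S\in\Pi^L_{(\mathfrak{m}^L(s_1;p_1),r_1)}(X,Y)$.
   Context: For a metric space $X$ with base point $x_0$, $X^{\#}$ is the Banach space of real-valued Lipschitz functions on $X$ vanishing at $x_0$, with norm $Lip(\cdot)$ (the Lipschitz constant); $B_{X^{\#}}$ is its closed unit ball. $(\sigma,x',x'')$ denotes a finite sequence $(\sigma_j,x'_j,x''_j)_{j=1}^m$ in $\mathbb{R}\times X\times X$. Indices lie in $(0,\infty]$, $1/\infty=0$. Put $\|(\sigma,x',x'')|\ell_p^{L,w}\|=\sup_{f\in B_{X^{\#}}}\big[\sum_j|\sigma_j|^p|f(x'_j)-f(x''_j)|^p\big]^{1/p}$ (sum replaced by supremum over $j$ if $p=\infty$). For $0<q\le s\le\infty$ let $s'(q)\in(0,\infty]$ be given by $\frac1{s'(q)}+\frac1s=\frac1q$, and put $\mathfrak{m}^L_{(s;q)}(\sigma,x',x'')=\inf_\tau\|\tau|\ell_{s'(q)}\|\,\|(\sigma/\tau,x',x'')|\ell_s^{L,w}\|$,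 the infimum over all $\tau=(\tau_j)$ with $\tau_j\in\mathbb{R}\setminus\{0\}$, where $\sigma/\tau=(\sigma_j/\tau_j)_j$. For $p\le q\le s$, a Lipschitz map $T:X\to Y$ is Lipschitz $(\mathfrak{m}^L(s;q),p)$-summing if there is $C\ge0$ with $\mathfrak{m}^L_{(s;q)}(\sigma,Tx',Tx'')\le C\,\|(\sigma,x',x'')|\ell_p^{L,w}\|$ for all finite sequences $(\sigma,x',x'')$ in $\mathbb{R}\times X\times X$; $\Pi^L_{(\mathfrak{m}^L(s;q),p)}(X,Y)$ is the class of all such maps and $\pi^L_{(\mathfrak{m}^L(s;q),p)}(T)$ is the infimum of such $C$. *)

(* Defs.v *)
From HB Require Import structures.
From mathcomp Require Import all_boot all_order all_algebra.
From mathcomp Require Import all_classical all_reals all_analysis.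

Set Implicit Arguments.
Unset Strict Implicit.
Unset Printing Implicit Defensive.

Import Order.TTheory GRing.Theory Num.Theory.
Import numFieldNormedType.Exports.

Local Open Scope classical_set_scope.
Local Open Scope ring_scope.

(* Diagonal pairs contribute 0 / 0 = 0, so that Lip f >= 0 always. *)
Definition Lip (R : realType) (X Y : metricType R) (f : X -> Y) : \bar R :=
  ereal_sup [set (mdist (f w.1) (f w.2) / mdist w.1 w.2)%:E | w in [set: X * X]].

Definition lipschitz_map (R : realType) (X Y : metricType R) (f : X -> Y) :=
  (Lip f < +oo)%E.

Definition lip_dual (R : realType) (X : metricType R) (x0 : X) : set (X -> R^o) :=
  [set f : X -> R^o | lipschitz_map f /\ f x0 = 0].

Definition lip_dual_ball (R : realType) (X : metricType R) (x0 : X) :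
    set (X -> R^o) :=
  [set f : X -> R^o | lip_dual x0 f /\ (Lip f <= 1)%E].

(* Only used for 0 < p <= +oo. *)
Definition lnorm (R : realType) (p : \bar R) (m : nat) (a : 'I_m -> R) : R :=
  match p with
  | r%:E => (\sum_(j < m) `|a j| `^ r) `^ r^-1
  | _ => \big[Num.max/0]_(j < m) `|a j|
  end.

Definition weak_lip_norm (R : realType) (X : metricType R) (x0 : X) (p : \bar R)
    (m : nat) (sigma : 'I_m -> R) (x' x'' : 'I_m -> X) : \bar R :=
  ereal_sup [set (lnorm p (fun j => `|sigma j| * `|f (x' j) - f (x'' j)|))%:E
            | f in lip_dual_ball x0].

(* In \bar R, 0^-1 = +oo and +oo^-1 = 0. *)
Definition conj_exp (R : realType) (s q : \bar R) : \bar R :=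
  (q^-1 - s^-1)^-1%E.

Lemma conj_expP (R : realType) (s q : \bar R) : (0 < q)%E -> (q <= s)%E ->
  (0 < conj_exp s q)%E /\ ((conj_exp s q)^-1 + s^-1 = q^-1)%E.
Proof.
move=> q0 qs; have s0 := lt_le_trans q0 qs.
have sfin : s^-1%E \is a fin_num.
  by rewrite fin_numV// ?gt_eqF// (lt_trans _ s0)// ltNy0.
have qfin : q^-1%E \is a fin_num.
  by rewrite fin_numV// ?gt_eqF// (lt_trans _ q0)// ltNy0.
split; last by rewrite /conj_exp inveK subeK.
have d0 : (0 <= q^-1 - s^-1)%E.
  rewrite sube_ge0 ?sfin ?orbT// lee_pV2//; exact: ltW.
rewrite lt_def /conj_exp inve_ge0 d0 andbT inve_eq0.
by rewrite lt_eqF// ltey_eq fin_numB sfin qfin.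
Qed.

Definition mixed_norm (R : realType) (X : metricType R) (x0 : X) (s q : \bar R)
    (m : nat) (sigma : 'I_m -> R) (x' x'' : 'I_m -> X) : \bar R :=
  ereal_inf [set ((lnorm (conj_exp s q) tau)%:E *
                  weak_lip_norm x0 s (fun j => sigma j / tau j)%R x' x'')%E
            | tau in [set tau : 'I_m -> R | forall j, tau j != 0]].

Definition mixed_summing_const (R : realType) (X Y : metricType R) (x0 : X)
    (y0 : Y) (s q p : \bar R) (T : X -> Y) : set R :=
  [set C | 0 <= C /\
    forall (m : nat) (sigma : 'I_m -> R) (x' x'' : 'I_m -> X),
      (mixed_norm y0 s q sigma (T \o x') (T \o x'')
         <= C%:E * weak_lip_norm x0 p sigma x' x'')%E].

(* Lipschitz (m^L(s;q),p)-summing maps, for 0 < p <= q <= s. *)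
Definition mixed_summing (R : realType) (X Y : metricType R) (x0 : X) (y0 : Y)
    (s q p : \bar R) : set (X -> Y) :=
  [set T | lipschitz_map T /\ mixed_summing_const x0 y0 s q p T !=set0].

Definition mixed_summing_norm (R : realType) (X Y : metricType R) (x0 : X)
    (y0 : Y) (s q p : \bar R) (T : X -> Y) : \bar R :=
  ereal_inf [set C%:E | C in mixed_summing_const x0 y0 s q p T].

(* Main.v *)
Require Import Defs.
From HB Require Import structures.
From mathcomp Require Import all_boot all_order all_algebra.
From mathcomp Require Import all_classical all_reals all_analysis.
From mathcomp Require Import ring.
Import Order.TTheory GRing.Theory Num.Theory.
Import numFieldNormedType.Exports.

Local Open Scope classical_set_scope.

(** The infimum over [tau] that defines the mixed norm has a dual description
as a supremum, and in the dual form every inclusion becomes an application of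
Hoelder's inequality.

Fix a finite sequence of pairs [(x'_j, x''_j)] and an index [s].  A vector [b]
is weakly dominated at [s] ([weakly_dominated]) when, for all coefficients [c],
the [s]-norm of [c b] is at most the weak [s]-norm of [(c, x', x'')].  For
finite [s] and nonnegative [b] this says that the vector of the [b_j ^ s] lies
in the closed convex hull of the vectors [|f (x'_j) - f (x''_j)| ^ s], [f]
Lipschitz in the unit ball, up to decreasing coordinates; so [b] stands for
the [L_s]-norms of the evaluations with respect to a probability on that ball.
The set is cut out by half-spaces, so that no hull and no measure is needed.

Duality: the mixed norm of [(sigma, x', x'')] with indices [(s; q)] is the
supremum of the [q]-norms of [sigma b] over all [b] dominated at [s].  One
inequality ([weakly_dominated_mixed]) is Hoelder's.  The other one
([mixed_le_dominated]) needs a [tau] adapted to all [f] at once.  For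
[q < s < +oo] put [k_j = b_j ^ s].  These [k] form a compact convex set, and on
it the concave function [\sum_j |sigma_j| ^ q * k_j ^ (q / s)], slightly
perturbed to be smooth, has a maximizer [v]; the first-order condition at [v]
([concave_sum_maximizer]) is a linear inequality in [k] which, for the [k]
coming from a single [f], bounds the weak norm of [sigma / tau] with
[tau_j ^ s'(q) = |sigma_j| ^ q * v_j ^ (q / s)].

The second ingredient is that Hoelder's inequality is sharp
([lnorm_le_dual]): an [r]-norm is bounded as soon as the [p]-norms of all
[w a] are, where [w] runs over the unit ball for the exponent complementary
to [r] in [p].  It gives that domination at [s2] implies domination at
[s1 >= s2] ([weakly_dominated_le]).

Now let [C] be a constant for the indices [(s1; p1), r1], let [b] be dominated
by the image pairs at [s2], hence at [s1], and let [1/t = 1/p1 - 1/p2].  For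
[w] in the unit ball of the [t]-norm, the [p1]-norm of [w sigma b] is at most
the mixed norm of [w sigma] in [Y], hence at most [C] times the weak [r1]-norm
of [w sigma] in [X], hence at most [C] times the weak [r2]-norm of [sigma],
by Hoelder since [1/r1 <= 1/t + 1/r2].  By sharpness the [p2]-norm of
[sigma b] has the same bound, and by duality so has the mixed norm for
[(s2; p2)].  Thus [C] is also a constant for the indices [(s2; p2), r2]. *)

(** * Hoelder's inequality and its sharpness for all exponents up to infinity *)

Section FiniteNorms.
Set Implicit Arguments.
Unset Strict Implicit.
Local Open Scope ring_scope.
Variable R : realType.
Implicit Types (x y K : R) (p q r : \bar R).

(** Weighted arithmetic-geometric mean inequality: Young's inequality, stated so
    that a weight may vanish. *)
Lemma powR_amgm x y (al be : R) : 0 <= x -> 0 <= y -> 0 <= al -> 0 <= be ->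
  al + be = 1 -> x `^ al * y `^ be <= al * x + be * y.
Proof.
move=> x0 y0; rewrite le_eqVlt => /predU1P[<- _ |al0].
  by rewrite add0r => ->; rewrite powRr0 powRr1// !mul1r mul0r add0r.
rewrite le_eqVlt => /predU1P[<-|be0 albe].
  by rewrite addr0 => ->; rewrite powRr0 powRr1// mulr1 mul1r mul0r addr0.
have := @conjugate_powR R (x `^ al) (y `^ be) al^-1 be^-1.
rewrite !powR_ge0 !invr_gt0 !invrK -!powRrM !mulfV ?gt_eqF// !powRr1//.
by rewrite [x * _]mulrC [y * _]mulrC; exact.
Qed.

Lemma powRK (r : R) x : r != 0 -> 0 <= x -> (x `^ r) `^ r^-1 = x.
Proof. by move=> r0 x0; rewrite -powRrM mulfV// powRr1. Qed.

Lemma powRVK (r : R) x : r != 0 -> 0 <= x -> (x `^ r^-1) `^ r = x.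
Proof. by move=> r0 x0; rewrite -powRrM mulVf// powRr1. Qed.

Lemma ler_powR_root (r : R) x y : 0 < r -> 0 <= x -> 0 <= y ->
  (x `^ r^-1 <= y) = (x <= y `^ r).
Proof.
move=> r0 x0 y0; apply/idP/idP => [h|h].
- rewrite -(@powRVK r x) ?gt_eqF//; apply: ge0_ler_powR => //.
    exact: ltW.
  by rewrite nnegrE powR_ge0.
- rewrite -(@powRK r y) ?gt_eqF//; apply: ge0_ler_powR => //.
    by rewrite invr_ge0 ltW.
  by rewrite nnegrE powR_ge0.
Qed.

Lemma lnorm_fin_le (r : R) m (a : 'I_m -> R) K : 0 < r -> 0 <= K ->
  (lnorm r%:E a <= K) = (\sum_j `|a j| `^ r <= K `^ r).
Proof.
by move=> r0 K0; rewrite ler_powR_root ?sumr_ge0// => j _; exact: powR_ge0.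
Qed.

Lemma lnorm_ge0 p m (a : 'I_m -> R) : 0 <= lnorm p a.
Proof.
case: p => [r| |] /=; first exact: powR_ge0.
all: exact: bigmax_ge_id.
Qed.

(** The exponent [1/p] as a real number, with [1/+oo = 0]: it lets the infinite
    exponent be treated together with the finite ones. *)
Definition rec_exp p : R := fine p^-1%E.

Lemma rec_exp_fin (r : R) : 0 < r -> rec_exp r%:E = r^-1.
Proof. by move=> r0; rewrite /rec_exp inver gt_eqF. Qed.

Lemma rec_exp_ge0 p : (0 < p)%E -> 0 <= rec_exp p.
Proof. by move=> p0; rewrite fine_ge0// inve_ge0 ltW. Qed.

Lemma rec_exp_fineK p : (0 < p)%E -> (rec_exp p)%:E = p^-1%E.
Proof.
move=> p0; rewrite /rec_exp fineK// fin_numV//; first by rewrite gt_eqF.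
by rewrite gt_eqF// (lt_trans _ p0).
Qed.

(** One description of the balls that covers finite and infinite [p] alike:
    [x_j] is [(|a_j| / K) ^ p] for finite [p], while for [p = +oo] the factor
    [x_j ^ 0] is [1] and any [x] will do. *)
Lemma lnorm_leP {p m} {a : 'I_m -> R} {K} : (0 < p)%E -> 0 <= K ->
  lnorm p a <= K <->
  exists x : 'I_m -> R, [/\ forall j, 0 <= x j, \sum_j x j <= 1 &
                            forall j, `|a j| <= K * x j `^ rec_exp p].
Proof.
case: p => [r| |//] p0 K0.
- rewrite lte_fin in p0; rewrite lnorm_fin_le// rec_exp_fin//; split.
  + move: K0; rewrite le_eqVlt => /predU1P[<-|K0] h.
      exists (fun=> 0); split => // [|j]; first by rewrite big1.
      rewrite mul0r; move: h; rewrite powR0 ?gt_eqF// => h.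
      have /eqP : \sum_j `|a j| `^ r = 0.
        by apply/eqP; rewrite eq_le h sumr_ge0// => i _; exact: powR_ge0.
      rewrite psumr_eq0 => [|i _]; last exact: powR_ge0.
      by move=> /allP/(_ j (mem_index_enum _))/= /eqP/powR_eq0_eq0 ->.
    exists (fun j => (`|a j| / K) `^ r); split => [j||j]; first exact: powR_ge0.
      have E j : (`|a j| / K) `^ r = `|a j| `^ r / K `^ r.
        by rewrite powRM ?invr_ge0 ?(ltW K0)// -powR_inv1 ?(ltW K0)//
          -powRrM mulN1r powRN.
      rewrite (eq_bigr _ (fun j _ => E j)) -mulr_suml.
      by rewrite ler_pdivrMr ?powR_gt0// mul1r.
    rewrite powRK ?gt_eqF// ?divr_ge0 ?(ltW K0)//.
    by rewrite mulrC divfK ?gt_eqF.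
  + move=> [x [x0 sx ax]].
    have h j : `|a j| `^ r <= K `^ r * x j.
      rewrite -[x j](@powRVK r) ?gt_eqF// -powRM ?powR_ge0//.
      by apply: ge0_ler_powR => //; rewrite ?(ltW p0) ?nnegrE ?mulr_ge0 ?powR_ge0.
    apply: (le_trans (ler_sum _ (fun j _ => h j))).
    by rewrite -mulr_sumr ler_piMr// powR_ge0.
- rewrite /rec_exp invey/=; split.
  + move=> /bigmax_leP[_ h]; exists (fun=> 0); split => // [|j].
      by rewrite big1.
    by rewrite powRr0 mulr1; exact: h.
  + move=> [x [_ _ h]]; apply/bigmax_leP; split => // j _.
    by rewrite (le_trans (h j))// powRr0 mulr1.
Qed.

Lemma unit_sum_le1 m (x : 'I_m -> R) j : (forall i, 0 <= x i) ->
  \sum_i x i <= 1 -> x j <= 1.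
Proof.
move=> x0; apply: le_trans.
by rewrite (bigD1 j)//= lerDl sumr_ge0.
Qed.

Lemma le_lnorm p m (a b : 'I_m -> R) : (0 < p)%E ->
  (forall j, `|a j| <= `|b j|) -> lnorm p a <= lnorm p b.
Proof.
move=> p0 ab; have [x [x0 sx bx]] :=
  (lnorm_leP (a := b) p0 (lnorm_ge0 p b)).1 (lexx _).
apply/(lnorm_leP p0 (lnorm_ge0 _ _)); exists x; split => // j.
exact: le_trans (bx j).
Qed.

Lemma lnorm_coord p m (a : 'I_m -> R) j : (0 < p)%E -> `|a j| <= lnorm p a.
Proof.
move=> p0; have [x [x0 sx ax]] :=
  (lnorm_leP (a := a) p0 (lnorm_ge0 p a)).1 (lexx _).
apply: (le_trans (ax j)); rewrite ler_piMr ?lnorm_ge0//.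
have <- : 1 `^ rec_exp p = 1 by rewrite powR1.
apply: ge0_ler_powR; rewrite ?nnegrE ?rec_exp_ge0//.
exact: unit_sum_le1.
Qed.

(** An inequality between reciprocals suffices since the norms decrease as the
    exponent grows.  If [x] and [y] are the weights of [a] and [b], a convex
    combination [z] of them is a weight for the product: by the
    arithmetic-geometric mean inequality [x ^ (1/q) * y ^ (1/r)] is at most
    [z ^ (1/q + 1/r)], and [z <= 1]. *)
Lemma lnorm_holder p q r m (a b : 'I_m -> R) :
  (0 < p)%E -> (0 < q)%E -> (0 < r)%E -> (p^-1 <= q^-1 + r^-1)%E ->
  lnorm p (fun j => a j * b j) <= lnorm q a * lnorm r b.
Proof.
move=> p0 q0 r0; rewrite -!rec_exp_fineK// -EFinD lee_fin => pqr.
have [x [x0 sx ax]] := (lnorm_leP (a := a) q0 (lnorm_ge0 q a)).1 (lexx _).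
have [y [y0 sy by_]] := (lnorm_leP (a := b) r0 (lnorm_ge0 r b)).1 (lexx _).
have qe := rec_exp_ge0 q0; have re := rec_exp_ge0 r0; have pe := rec_exp_ge0 p0.
apply/(lnorm_leP p0 (mulr_ge0 (lnorm_ge0 _ _) (lnorm_ge0 _ _))).
suff [z [z0 sz hz]] : exists z : 'I_m -> R, [/\ forall j, 0 <= z j,
    \sum_j z j <= 1 &
    forall j, x j `^ rec_exp q * y j `^ rec_exp r <= z j `^ rec_exp p].
  exists z; split => // j; rewrite normrM.
  apply: (le_trans (ler_pM _ _ (ax j) (by_ j))) => //.
  by rewrite mulrACA ler_wpM2l ?hz// mulr_ge0 ?lnorm_ge0.
(* Here q = r = +oo, and then p = +oo. *)
have [e0|e0] := eqVneq (rec_exp q + rec_exp r) 0.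
  have /andP[/eqP -> /eqP ->] : (rec_exp q == 0) && (rec_exp r == 0).
    by rewrite -paddr_eq0// e0.
  have -> : rec_exp p = 0 by apply/eqP; rewrite eq_le pe -e0 pqr.
  by exists x; split => // j; rewrite !powRr0 mulr1.
set e := rec_exp q + rec_exp r in e0 pqr.
have e1 : 0 < e by rewrite lt_def e0 addr_ge0.
have sum1 : rec_exp q / e + rec_exp r / e = 1 by rewrite -mulrDl mulfV.
pose z j := rec_exp q / e * x j + rec_exp r / e * y j.
have z0 j : 0 <= z j by rewrite addr_ge0// mulr_ge0// divr_ge0// ltW.
have sz : \sum_j z j <= 1.
  rewrite big_split/= -!mulr_sumr -sum1.
  by rewrite lerD// ler_piMr// divr_ge0// ltW.
exists z; split => // j.
have -> : x j `^ rec_exp q * y j `^ rec_exp r =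
    (x j `^ (rec_exp q / e) * y j `^ (rec_exp r / e)) `^ e.
  by rewrite powRM ?powR_ge0// -!powRrM !divfK.
apply: (@le_trans _ _ (z j `^ e)).
  apply: ge0_ler_powR; rewrite ?nnegrE ?mulr_ge0 ?powR_ge0 ?(ltW e1) ?z0//.
  by apply: powR_amgm => //; rewrite divr_ge0// ltW.
have := z0 j; rewrite le_eqVlt => /predU1P[<-|zj].
  by rewrite powR0// powR_ge0.
by apply: ger_powR => //; rewrite zj unit_sum_le1.
Qed.

(** The extremal [w] in Hoelder's inequality: for finite [r] it is the power
    [1/q] of [|a_j| ^ r] normalized to sum [1], and for [r = +oo] the indicator
    of a coordinate. *)
Lemma lnorm_le_dual p q r m (a : 'I_m -> R) K :
  (0 < p)%E -> (0 < q)%E -> (0 < r)%E -> (p^-1 = q^-1 + r^-1)%E -> 0 <= K ->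
  (forall w, lnorm q w <= 1 -> lnorm p (fun j => w j * a j) <= K) ->
  lnorm r a <= K.
Proof.
move=> p0 q0 r0 + K0 h; rewrite -!rec_exp_fineK// => -[pqr].
have {}h (x : 'I_m -> R) : (forall j, 0 <= x j) -> \sum_j x j <= 1 ->
    lnorm p (fun j => x j `^ rec_exp q * a j) <= K.
  move=> x0 sx; apply: h; apply/(lnorm_leP q0 ler01).
  by exists x; split => // j; rewrite mul1r ger0_norm ?powR_ge0.
case: r r0 pqr => [r| |//] r0 pqr.
- rewrite lte_fin in r0; rewrite rec_exp_fin// in pqr.
  have rN0 : r != 0 by rewrite gt_eqF.
  case: p p0 pqr h => [p| |//] p0 pqr h; last first.
    have : 0 < rec_exp q + r^-1 by rewrite ltr_wpDl ?rec_exp_ge0 ?invr_gt0.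
    by rewrite -pqr /rec_exp invey ltxx.
  rewrite lte_fin in p0; rewrite rec_exp_fin// in pqr.
  rewrite lnorm_fin_le//; set A := \sum_j _.
  have A0 : 0 <= A by rewrite sumr_ge0// => j _; exact: powR_ge0.
  move: (A0); rewrite le_eqVlt => /predU1P[<-|A1]; first exact: powR_ge0.
  have AV : 0 <= A^-1 by rewrite invr_ge0.
  pose x j := `|a j| `^ r / A.
  have x0 j : 0 <= x j by rewrite mulr_ge0 ?powR_ge0.
  have sx : \sum_j x j = 1 by rewrite -mulr_suml mulfV ?gt_eqF.
  have := h x x0; rewrite sx lexx => /(_ isT); rewrite lnorm_fin_le//.
  have E j : `|x j `^ rec_exp q * a j| `^ p = (A `^ r^-1) `^ p * x j.
    have -> : `|x j `^ rec_exp q * a j| = A `^ r^-1 * x j `^ p^-1.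
      have -> : x j `^ p^-1 = x j `^ rec_exp q * x j `^ r^-1.
        by rewrite pqr powRD// -pqr invr_eq0 gt_eqF.
      rewrite normrM ger0_norm ?powR_ge0// mulrCA -powRM//.
      by congr (_ * _); rewrite /x mulrC divfK ?gt_eqF// powRK.
    by rewrite powRM ?powR_ge0// powRVK ?gt_eqF.
  rewrite (eq_bigr _ (fun j _ => E j)) -mulr_sumr sx mulr1.
  move=> H; rewrite -ler_powR_root//.
  by rewrite -(@ler_powR_root p) ?powR_ge0// powRK ?powR_ge0 ?gt_eqF in H.
- apply/bigmax_leP; split => // j _.
  have := h (fun i => (i == j)%:R).
  have s1 : \sum_(i < m) (i == j)%:R = 1 :> R.
    by rewrite (bigD1 j)//= eqxx big1 ?addr0// => i /negbTE ->.
  rewrite s1 lexx => /(_ (fun=> ler0n _ _) isT).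
  apply: le_trans; apply: le_trans (lnorm_coord _ j p0).
  by rewrite eqxx powR1 mul1r.
Qed.
End FiniteNorms.

(** * Maximizing a concave power sum over a compact convex set *)

Section Optim.
Local Open Scope ring_scope.
Set Implicit Arguments.
Unset Strict Implicit.
Variable R : realType.
Implicit Types (x y v th : R).

(** A concave power lies below its tangents. *)
Lemma powR_tangent x v th : 0 <= x -> 0 < v -> 0 <= th <= 1 ->
  x `^ th <= v `^ th + th * v `^ (th - 1) * (x - v).
Proof.
move=> x0 v0 /andP[t0 t1].
have vN0 : v != 0 by rewrite gt_eqF.
have h : x `^ th * v `^ (1 - th) <= th * x + (1 - th) * v.
  by apply: powR_amgm; rewrite ?(ltW v0) ?subr_ge0 // addrC subrK.
have e1 : v `^ (1 - th) * v `^ (th - 1) = 1.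
  by rewrite -powRD ?vN0 ?implybT// addrA subrK subrr powRr0.
have e2 : v `^ th = v `^ (th - 1) * v.
  by rewrite -[X in _ * X]powRr1 ?(ltW v0)// -powRD ?vN0 ?implybT// subrK.
have -> : x `^ th = x `^ th * v `^ (1 - th) * v `^ (th - 1).
  by rewrite -mulrA e1 mulr1.
apply: (le_trans (ler_wpM2r (powR_ge0 _ _) h)).
rewrite e2 le_eqVlt; apply/orP; left; apply/eqP; ring.
Qed.

Lemma continuous_powR_gt0 th v : 0 < v -> {for v, continuous (fun x : R => x `^ th)}.
Proof.
move=> v0; apply: differentiable_continuous; apply/derivable1_diffP.
by apply: derivable_powR; rewrite in_itv/= andbT.
Qed.

Lemma cvg_sumr {T : Type} (F : set_system T) {FF : Filter F} m
    (f : 'I_m -> T -> R) (l : 'I_m -> R) :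
  (forall j, f j t @[t --> F] --> l j) ->
  \sum_j f j t @[t --> F] --> \sum_j l j.
Proof.
by move=> fl; apply: cvg_big => //; exact: add_continuous.
Qed.

(** The first-order condition at a maximizer [v].  The directional derivative of
    the power sum from [v] towards [k] is nonpositive; the shift [eps] keeps the
    derivative finite where [v] has a zero coordinate. *)
Lemma concave_sum_maximizer m (G : set 'rV[R]_m) (a : 'I_m -> R) (th eps : R) :
  G !=set0 -> compact G -> (forall k j, G k -> 0 <= k ord0 j) ->
  (forall k l t, G k -> G l -> 0 <= t <= 1 -> G (k + t *: (l - k))) ->
  (forall j, 0 <= a j) -> 0 < eps -> 0 < th <= 1 ->
  exists2 v, G v & forall k, G k ->
    \sum_j a j * (v ord0 j + eps) `^ (th - 1) * k ord0 j <=
    \sum_j a j * (v ord0 j + eps) `^ th.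
Proof.
move=> Gn0 Gc G0 Gconv a0 e0 /andP[t0 t1].
pose phi (k : 'rV[R]_m) := \sum_j a j * (k ord0 j + eps) `^ th.
have phic : {within G, continuous phi}.
  apply: continuous_in_subspaceT => k /set_mem Gk.
  apply: (@cvg_sumr _ (nbhs k)) => j; apply: cvgMl_tmp.
  apply: (@continuous_comp _ _ _ (fun k : 'rV[R]_m => k ord0 j + eps)
    (fun x : R => x `^ th)).
    apply: (@cvgD R R _ (nbhs k)); last exact: cvg_cst.
    exact: (@coord_continuous R 1 m ord0 j k).
  by apply: continuous_powR_gt0; rewrite ltr_wpDl ?G0.
have [v /set_mem Gv vmax] := EVT_max_rV Gn0 Gc phic.
exists v => // k Gk.
pose d j := k ord0 j - v ord0 j.
pose D (t : R) := \sum_j a j * (v ord0 j + t * d j + eps) `^ (th - 1) * d j.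
(* D t is, up to the factor th, the slope at the point v + t (k - v).  The
   tangent at that point lies above the sum at v, which is maximal; this makes
   the slope nonpositive for t > 0, and D 0 is its limit. *)
have Dle0 t : 0 < t <= 1 -> D t <= 0.
  move=> /andP[tp t1'].
  have Gu : G (v + t *: (k - v)) by apply: Gconv; rewrite // (ltW tp).
  set u := v + _ in Gu.
  have uE j : u ord0 j = v ord0 j + t * d j by rewrite !mxE.
  have h : phi v <= phi u + th * (- t * D t).
    rewrite /D !mulr_sumr -big_split/=; apply: ler_sum => j _.
    have := @powR_tangent (v ord0 j + eps) (u ord0 j + eps) th.
    rewrite t1 (ltW t0) addr_ge0 ?G0 ?(ltW e0)// ltr_wpDl ?G0//.
    move=> /(_ isT isT isT) /(ler_wpM2l (a0 j)) /le_trans; apply.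
    rewrite le_eqVlt; apply/orP; left; apply/eqP; rewrite uE; ring.
  have := le_trans h (lerD (vmax u (mem_set Gu)) (lexx _)).
  by rewrite lerDl pmulr_rge0// mulNr oppr_ge0 pmulr_rle0.
have D0 : D 0 <= 0.
  have cD : D t @[t --> 0^'+] --> D 0.
    apply: cvg_at_right_filter; apply: cvg_sumr => j.
    apply: cvgMr_tmp; apply: cvgMl_tmp.
    apply: (@continuous_comp _ _ _ (fun t : R => v ord0 j + t * d j + eps)
      (fun x : R => x `^ (th - 1))).
      apply: cvgD; last exact: cvg_cst.
      by apply: cvgD; [exact: cvg_cst|apply: cvgMr_tmp; exact: cvg_id].
    by apply: continuous_powR_gt0; rewrite mul0r addr0 ltr_wpDl ?G0.
  apply: (cvgr_to_le cD); near=> t; apply: Dle0; apply/andP; split.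
    by near: t; exact: nbhs_right_gt.
  by near: t; apply: nbhs_right_le.
have D0E : D 0 = \sum_j a j * (v ord0 j + eps) `^ (th - 1) * k ord0 j -
             \sum_j a j * (v ord0 j + eps) `^ (th - 1) * v ord0 j.
  rewrite -sumrB; apply: eq_bigr => j _.
  by rewrite mul0r addr0 mulrBr.
move: D0; rewrite D0E subr_le0 => /le_trans; apply; apply: ler_sum => j _.
have vj : 0 < v ord0 j + eps by rewrite ltr_wpDl ?G0.
have -> : (v ord0 j + eps) `^ th =
    (v ord0 j + eps) `^ (th - 1) * (v ord0 j + eps).
  by rewrite -[X in _ = _ * X]powRr1 ?(ltW vj)// -powRD ?subrK// gt_eqF.
by rewrite -mulrA ler_wpM2l// ler_wpM2l ?powR_ge0// lerDl ltW.
Unshelve. all: by end_near. Qed.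
Lemma powR_subadd x y th : 0 <= x -> 0 <= y -> 0 <= th <= 1 ->
  (x + y) `^ th <= x `^ th + y `^ th.
Proof.
move=> x0 y0 /andP[t0 t1].
have := addr_ge0 x0 y0; rewrite le_eqVlt => /predU1P[xy0|xy0].
  have /andP[/eqP -> _] : (x == 0) && (y == 0) by rewrite -paddr_eq0// -xy0.
  by rewrite add0r lerDr powR_ge0.
have h z : 0 <= z -> z <= x + y -> z / (x + y) * (x + y) `^ th <= z `^ th.
  rewrite le_eqVlt => /predU1P[<- _|z0 zxy]; first by rewrite !mul0r powR_ge0.
  have -> : z `^ th = (z / (x + y)) `^ th * (x + y) `^ th.
    by rewrite -powRM ?divr_ge0 ?(ltW z0) ?(ltW xy0)// divfK// gt_eqF.
  rewrite ler_wpM2r ?powR_ge0// ger1_powR// divr_gt0//=.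
  by rewrite ler_pdivrMr// mul1r.
have := lerD (h x x0 _) (h y y0 _); rewrite -mulrDl -mulrDl divff ?gt_eqF//.
by rewrite mul1r; apply; rewrite ?lerDl ?lerDr.
Qed.

(** The dominated vectors will be described by such half-spaces, from which
    convexity and compactness are read off without forming a convex hull. *)
Section Halfspaces.
Variables (I : Type) (m : nat) (phi : I -> 'I_m -> R) (N : I -> R).
Let G := [set k : 'rV[R]_m | (forall j, 0 <= k ord0 j) /\
  forall i, \sum_j phi i j * k ord0 j <= N i].

Lemma halfspaces_convex k l t : G k -> G l -> 0 <= t <= 1 ->
  G (k + t *: (l - k)).
Proof.
move=> [k0 kN] [l0 lN] /andP[t0 t1].
have E j : (k + t *: (l - k)) ord0 j = (1 - t) * k ord0 j + t * l ord0 j.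
  by rewrite !mxE; ring.
have t1' : 0 <= 1 - t by rewrite subr_ge0.
split => [j|i]; first by rewrite E addr_ge0 ?mulr_ge0.
under eq_bigr do rewrite E mulrDr !(mulrCA (phi i _)).
rewrite big_split/= -!mulr_sumr.
have -> : N i = (1 - t) * N i + t * N i by ring.
by rewrite lerD// ler_wpM2l.
Qed.

Lemma halfspaces_compact (B : 'I_m -> R) :
  (forall k j, G k -> k ord0 j <= B j) -> compact G.
Proof.
move=> GB.
apply: (@subclosed_compact _ _ [set v : 'rV[R]_m | forall j,
  `[0, B j]%classic (v ord0 j)]); last first.
- by move=> k Gk j /=; rewrite in_itv/= GB// (proj1 Gk).
- by apply: (@rV_compact R m (fun j => `[0, B j]%classic)) => j;
    exact: segment_compact.
have -> : G = (\bigcap_(j in [set: 'I_m]) [set k : 'rV[R]_m | 0 <= k ord0 j])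
   `&` (\bigcap_(i in [set: I])
     [set k : 'rV[R]_m | \sum_j phi i j * k ord0 j <= N i]).
  apply/seteqP; split => k /=.
    by move=> [k0 kN]; split => ? _ /=.
  by move=> [k0 kN]; split => ?; [exact: k0|exact: kN].
apply: closedI; apply: closed_bigI => i _.
  apply: (@closed_comp _ _ (fun k : 'rV[R]_m => k ord0 i) [set x | 0 <= x]).
    by move=> k _; exact: (@coord_continuous R 1 m ord0 i k).
  exact: closed_ge.
apply: (@closed_comp _ _ (fun k : 'rV[R]_m => \sum_j phi i j * k ord0 j)
  [set x | x <= N i]); last exact: closed_le.
move=> k _; apply: (@cvg_sumr _ (nbhs k)) => j; apply: cvgMl_tmp.
exact: (@coord_continuous R 1 m ord0 j k).
Qed.
End Halfspaces.
End Optim.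

(** * Weak norms and dominated vectors *)

Section MixedNorms.
Local Open Scope ring_scope.
Set Implicit Arguments.
Unset Strict Implicit.
Variable R : realType.

Lemma lip_dual_ballP (X : metricType R) (x0 : X) (f : X -> R^o) :
  lip_dual_ball x0 f <->
  f x0 = 0 /\ forall a b, `|f a - f b| <= mdist a b.
Proof.
split.
- move=> [[_ f0] Lf]; split => // a b.
  have [->|ab] := eqVneq a b; first by rewrite subrr normr0 mdist_ge0.
  have : ((mdist (f a) (f b) / mdist a b)%:E <= Lip f)%E.
    by apply: ereal_sup_ubound; exists (a, b).
  move=> /le_trans/(_ Lf); rewrite lee_fin ler_pdivrMr ?mdist_gt0// mul1r.
  by rewrite distrC.
- move=> [f0 fl].
  have L1 : (Lip f <= 1)%E.
    apply: ge_ereal_sup => _ [[a b] _ <-] /=; rewrite lee_fin.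
    have [->|ab] := eqVneq a b; first by rewrite !mdistxx mul0r.
    by rewrite ler_pdivrMr ?mdist_gt0// mul1r [leLHS]distrC.
  by split=> //; split=> //; rewrite /lipschitz_map (le_lt_trans L1)// ltry.
Qed.

(** These functions attain the distance to [z], so a unit-ball function separates
    any pair of points as much as their distance allows. *)
Lemma dist_in_ball (X : metricType R) (x0 z : X) :
  lip_dual_ball x0 (fun y => mdist y z - mdist x0 z).
Proof.
apply/lip_dual_ballP; split; first by rewrite subrr.
move=> a b; rewrite opprB addrA subrK ler_norml; apply/andP; split.
  by rewrite lerBrDl -lerBDr opprK [mdist a b]metric_sym addrC metric_triangle.
by rewrite lerBlDr metric_triangle.
Qed.

Section Weak.
Variables (X : metricType R) (x0 : X).
Variables (m : nat) (x' x'' : 'I_m -> X).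
Implicit Types (p q r s : \bar R) (sigma w : 'I_m -> R) (K : R).

Lemma weak_ub p sigma f : lip_dual_ball x0 f ->
  ((lnorm p (fun j => `|sigma j| * `|f (x' j) - f (x'' j)|))%:E
    <= weak_lip_norm x0 p sigma x' x'')%E.
Proof. by move=> Bf; apply: ereal_sup_ubound; exists f. Qed.

Lemma weak_le p sigma K :
  (forall f, lip_dual_ball x0 f ->
    lnorm p (fun j => `|sigma j| * `|f (x' j) - f (x'' j)|) <= K) ->
  (weak_lip_norm x0 p sigma x' x'' <= K%:E)%E.
Proof. by move=> h; apply: ge_ereal_sup => _ [f Bf <-]; rewrite lee_fin h. Qed.

Lemma weak_real p sigma : (0 < p)%E ->
  exists2 W : R, 0 <= W & weak_lip_norm x0 p sigma x' x'' = W%:E.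
Proof.
move=> p0.
have B0 : lip_dual_ball x0 (fun _ : X => 0 : R^o).
  by apply/lip_dual_ballP; split => // a b; rewrite subrr normr0 mdist_ge0.
have lb := weak_ub p sigma B0.
have ub : (weak_lip_norm x0 p sigma x' x'' <=
    (lnorm p (fun j => `|sigma j| * mdist (x' j) (x'' j)))%:E)%E.
  apply: weak_le => f /lip_dual_ballP[_ fl]; apply: le_lnorm => // j.
  by rewrite !normrM !normr_id ler_wpM2l// (ger0_norm (mdist_ge0 _ _)).
move: lb ub; case: (weak_lip_norm _ _ _ _ _) => [W| |]//=.
by rewrite lee_fin => h _; exists W => //; apply: le_trans h; exact: lnorm_ge0.
Qed.

Lemma weak_holder p q r w sigma : (0 < p)%E -> (0 < q)%E -> (0 < r)%E ->
  (p^-1 <= q^-1 + r^-1)%E ->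
  (weak_lip_norm x0 p (fun j => w j * sigma j)%R x' x'' <=
   (lnorm q w)%:E * weak_lip_norm x0 r sigma x' x'')%E.
Proof.
move=> p0 q0 r0 pqr; have [W W0 WE] := weak_real sigma r0.
rewrite WE -EFinM; apply: weak_le => f Bf.
apply: (@le_trans _ _ (lnorm p (fun j =>
    w j * (`|sigma j| * `|f (x' j) - f (x'' j)|)))).
  by apply: le_lnorm => // j; rewrite !normrM !normr_id mulrA.
apply: (le_trans (lnorm_holder _ _ p0 q0 r0 pqr)).
by rewrite ler_wpM2l ?lnorm_ge0// -lee_fin -WE weak_ub.
Qed.

(** Domination by the Lipschitz functions in the unit ball, tested against all
    coefficients; this is the polar form of being an [L_s]-norm of the
    evaluations for a probability on the ball. *)
Definition weakly_dominated s (b : 'I_m -> R) :=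
  forall c : 'I_m -> R,
    ((lnorm s (fun j => c j * b j)%R)%:E <= weak_lip_norm x0 s c x' x'')%E.

(** For probabilities this would be the monotonicity of [L_s]-norms in [s].  In
    polar form, the test at [t] is reduced by duality to tests at [s] with the
    coefficients [w c], and Hoelder's inequality removes [w] from the weak norm. *)
Lemma weakly_dominated_le s t b : (0 < s)%E -> (s <= t)%E ->
  weakly_dominated s b -> weakly_dominated t b.
Proof.
move=> s0 st bs c; have t0 := lt_le_trans s0 st.
have [u0 ust] := conj_expP s0 st; have [W W0 WE] := weak_real c t0.
rewrite WE lee_fin.
apply: (lnorm_le_dual (a := fun j => c j * b j) s0 u0 t0 (esym ust) W0) => w w1.
have := bs (fun j => w j * c j); rewrite -lee_fin.
under [X in lnorm _ X]eq_fun do rewrite -mulrA.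
move=> /le_trans; apply.
apply: (le_trans (weak_holder w c s0 u0 t0 _)); first by rewrite ust.
by rewrite WE -EFinM lee_fin ler_piMl.
Qed.

(** The easy half of the duality: each [tau] gives the bound by Hoelder's
    inequality for [sigma b = tau (sigma / tau) b]. *)
Lemma weakly_dominated_mixed s q b sigma : (0 < q)%E -> (q <= s)%E ->
  weakly_dominated s b ->
  ((lnorm q (fun j => sigma j * b j)%R)%:E <=
    mixed_norm x0 s q sigma x' x'')%E.
Proof.
move=> q0 qs bs; have s0 := lt_le_trans q0 qs; have [u0 usq] := conj_expP q0 qs.
apply: le_ereal_inf_tmp => _ [tau tau0 <-].
have [W W0 WE] := weak_real (fun j => sigma j / tau j) s0.
have := bs (fun j => sigma j / tau j); rewrite WE -EFinM !lee_fin => bW.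
apply: (@le_trans _ _ (lnorm q (fun j => tau j * (sigma j / tau j * b j)))).
  apply: le_lnorm => // j.
  by rewrite mulrA [tau j * _]mulrC divfK// tau0.
apply: (le_trans (lnorm_holder _ _ q0 u0 s0 _)); first by rewrite usq.
by rewrite ler_wpM2l ?lnorm_ge0.
Qed.

End Weak.
End MixedNorms.

(** * The mixed norm as a supremum over dominated vectors *)

Section Converse.
Local Open Scope ring_scope.
Set Implicit Arguments.
Unset Strict Implicit.
Variable R : realType.

(** The choice of [tau] in the core case.  With [a] close to [|sigma_j| ^ q] and
    [tau_j ^ u = a v ^ (q/s)], the [s]-th power of [|sigma_j / tau_j|] is at most
    the coefficient [a v ^ (q/s - 1)] of the first-order condition. *)
Lemma mixed_weight_le (q s u a v t : R) : 0 < q -> q < s -> u^-1 = q^-1 - s^-1 ->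
  0 < a -> 0 < v -> 0 <= t -> t `^ q <= a ->
  (t / (a * v `^ (q / s)) `^ u^-1) `^ s <= a * v `^ (q / s - 1).
Proof.
move=> q0 qs uE a0 v0 t0 ta.
have s0 : 0 < s by exact: lt_trans qs.
have [qN sN aN vN] : [/\ q != 0, s != 0, a != 0 & v != 0] by rewrite !gt_eqF.
have P0 : 0 <= a * v `^ (q / s) by rewrite mulr_ge0 ?powR_ge0 ?(ltW a0).
have us : u^-1 * s = s / q - 1 by rewrite uE mulrBl mulVf// mulrC.
rewrite powRM ?invr_ge0 ?powR_ge0// -powRN -powRrM mulNr us.
have ts : t `^ s <= a `^ (s / q).
  have -> : t `^ s = (t `^ q) `^ (s / q) by rewrite -powRrM mulrC divfK.
  apply: ge0_ler_powR; rewrite ?nnegrE ?powR_ge0 ?(ltW a0)//.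
  by rewrite divr_ge0 ?ltW.
apply: (le_trans (ler_wpM2r (powR_ge0 _ _) ts)).
rewrite powRM ?powR_ge0 ?(ltW a0)// mulrA -powRD ?aN ?implybT//.
rewrite -powRrM opprB addrC subrK powRr1 ?(ltW a0)//.
have -> : q / s * (1 - s / q) = q / s - 1.
  by rewrite mulrBr mulr1 mulrA divfK// mulfV.
by [].
Qed.

Section Fixed.
Variables (X : metricType R) (x0 : X).
Variables (m : nat) (x' x'' : 'I_m -> X).
Implicit Types (p q r s : \bar R) (sigma w : 'I_m -> R) (K : R).

Local Notation dom := (weakly_dominated x0 x' x'').

Lemma weakly_dominated_lip s f : (0 < s)%E -> lip_dual_ball x0 f ->
  dom s (fun j => `|f (x' j) - f (x'' j)|).
Proof.
move=> s0 Bf c.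
apply: le_trans (weak_ub _ _ _ _ Bf); rewrite lee_fin le_lnorm// => j.
by rewrite !normrM !normr_id.
Qed.

(** At [s = +oo] the vector of distances is dominated, and it is the largest
    candidate: it bounds every [|f (x'_j) - f (x''_j)|]. *)
Lemma weakly_dominated_dist : dom +oo%E (fun j => mdist (x' j) (x'' j)).
Proof.
move=> c; have [W W0 WE] := weak_real x0 x' x'' c (ltry 0).
rewrite WE lee_fin; apply/bigmax_leP; split => // j _.
have := weak_ub x' x'' +oo%E c (dist_in_ball x0 (x'' j)).
rewrite WE lee_fin; apply: le_trans.
have := @lnorm_coord R +oo%E m (fun i => `|c i| *
  `|(mdist (x' i) (x'' j) - mdist x0 (x'' j)) -
    (mdist (x'' i) (x'' j) - mdist x0 (x'' j))|) j (ltry 0).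
apply: le_trans.
by rewrite !normrM !normr_id mdistxx opprB addrA subrK subr0.
Qed.

Lemma mixed_le s q sigma tau K : (0 < q)%E -> (q <= s)%E ->
  (forall j, tau j != 0) ->
  (forall f, lip_dual_ball x0 f -> lnorm (conj_exp s q) tau *
     lnorm s (fun j => `|sigma j / tau j| * `|f (x' j) - f (x'' j)|) <= K) ->
  (mixed_norm x0 s q sigma x' x'' <= K%:E)%E.
Proof.
move=> q0 qs tau0 h; have s0 := lt_le_trans q0 qs.
apply: (@le_trans _ _ ((lnorm (conj_exp s q) tau)%:E *
   weak_lip_norm x0 s (fun j => sigma j / tau j)%R x' x'')%E).
  by apply: ereal_inf_lbound; exists tau.
(* The factor of tau may vanish only when the sequence is empty, but treating
   0 separately avoids that discussion: 0 times a real weak norm is 0. *)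
have := lnorm_ge0 (conj_exp s q) tau; rewrite le_eqVlt => /predU1P[L0|L0].
  have [W W0 WE] := weak_real x0 x' x'' (fun j => sigma j / tau j) s0.
  have := h _ (dist_in_ball x0 x0).
  by rewrite -L0 mul0r WE -EFinM mul0r lee_fin.
rewrite muleC -lee_pdivlMr// -EFinM; apply: weak_le => f Bf.
by rewrite ler_pdivlMr// mulrC h.
Qed.

(** For [s = +oo] one takes [tau_j = |sigma_j| d(x'_j, x''_j)], enlarged a little
    to be nonzero; then every [|sigma_j / tau_j| |f (x'_j) - f (x''_j)|] is at
    most [1]. *)
Lemma mixed_le_infty q sigma K : (0 < q)%E -> 0 <= K ->
  lnorm q (fun j => sigma j * mdist (x' j) (x'' j)) <= K ->
  (mixed_norm x0 +oo%E q sigma x' x'' <= K%:E)%E.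
Proof.
move=> q0 K0 hK; apply/lee_addgt0Pr => e e0; rewrite -EFinD.
have uE : conj_exp +oo%E q = q by rewrite /conj_exp invey sube0 inveK.
have [tau [tau0 taule tauK]] : exists tau : 'I_m -> R,
   [/\ forall j, 0 < tau j,
       forall j, `|sigma j| * mdist (x' j) (x'' j) <= tau j &
       lnorm q tau <= K + e].
  have Ke : 0 <= K + e by rewrite addr_ge0 ?(ltW e0).
  have ab j : `|sigma j * mdist (x' j) (x'' j)| =
      `|sigma j| * mdist (x' j) (x'' j).
    by rewrite normrM [X in _ * X]ger0_norm ?mdist_ge0.
  case: q q0 hK uE => [q| |//] q0 hK _.
  - rewrite lte_fin in q0; rewrite lnorm_fin_le// in hK.
    have qN : q != 0 by rewrite gt_eqF.
    (* Adding d to each q-th power spreads the room left between K ^ q and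
       (K + e) ^ q over the m coordinates; m.+1 avoids a division by 0. *)
    pose d := ((K + e) `^ q - K `^ q) / m.+1%:R.
    have d0 : 0 < d.
      rewrite divr_gt0// subr_gt0; apply: gt0_ltr_powR; rewrite ?nnegrE//.
      by rewrite ltrDl.
    pose t j := `|sigma j * mdist (x' j) (x'' j)| `^ q + d.
    have t0 j : 0 < t j by rewrite ltr_wpDl ?powR_ge0.
    exists (fun j => t j `^ q^-1); split => [j|j|]; first exact: powR_gt0.
      rewrite -ab -[leLHS](@powRK _ q)//; apply: ge0_ler_powR.
      - by rewrite invr_ge0 ltW.
      - by rewrite nnegrE powR_ge0.
      - by rewrite nnegrE ltW.
      - by rewrite lerDl ltW.
    rewrite lnorm_fin_le//.
    under eq_bigr do rewrite ger0_norm ?powR_ge0// powRVK ?(ltW (t0 _))//.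
    rewrite big_split/= sumr_const card_ord -mulr_natr.
    apply: (le_trans (lerD hK (lexx _))); rewrite -lerBrDl /d.
    rewrite -mulrA ler_piMr//.
      by rewrite subr_ge0; apply: ge0_ler_powR; rewrite ?nnegrE ?lerDl// ltW.
    by rewrite mulrC ler_pdivrMr// mul1r ler_nat.
  - exists (fun j => `|sigma j * mdist (x' j) (x'' j)| + e); split => [j|j|].
    + by rewrite ltr_wpDl.
    + by rewrite ab lerDl ltW.
    apply/bigmax_leP; split => // j _.
    rewrite ger0_norm ?addr_ge0 ?(ltW e0)// lerD2r.
    by apply: le_trans hK; exact: (lnorm_coord (p := +oo%E)).
apply: (@mixed_le _ _ _ tau) => //; first exact: leey.
  by move=> j; rewrite gt_eqF.
move=> f /lip_dual_ballP[_ fl]; rewrite uE.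
apply: le_trans tauK; rewrite ler_piMr ?lnorm_ge0//.
apply/bigmax_leP; split => // j _.
rewrite !normrM !normr_id normfV (gtr0_norm (tau0 j)) mulrAC.
rewrite ler_pdivrMr// mul1r; apply: le_trans (taule j).
by rewrite ler_wpM2l.
Qed.

(** For [s = q] the index [s'(q)] is infinite and [tau = 1] is admissible. *)
Lemma mixed_le_diag (s : R) sigma K : 0 < s ->
  (forall b, dom s%:E b -> lnorm s%:E (fun j => sigma j * b j) <= K) ->
  (mixed_norm x0 s%:E s%:E sigma x' x'' <= K%:E)%E.
Proof.
move=> s0 h; apply: (@mixed_le _ _ _ (fun=> 1)) => //.
move=> f Bf; have uE : conj_exp s%:E s%:E = +oo%E.
  by rewrite /conj_exp subee ?inve0// inver gt_eqF.
have l1 : lnorm +oo%E (fun _ : 'I_m => 1 : R) <= 1.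
  by apply/bigmax_leP; split => // j _; rewrite normr1.
rewrite uE; have := h _ (weakly_dominated_lip (s := s%:E) s0 Bf); apply: le_trans.
apply: (le_trans (ler_wpM2r (lnorm_ge0 _ _) l1)); rewrite mul1r.
by apply: le_lnorm => // j; rewrite !normrM !normr_id invr1 normr1 mulr1.
Qed.


(** The core of the duality, where one [tau] has to serve all [f]: it is read off
    from a maximizer over the vectors [k_j = b_j ^ s] with [b] dominated. *)
Lemma mixed_le_fin (q s : R) sigma K : 0 < q -> q < s -> 0 <= K ->
  (forall b, dom s%:E b -> lnorm q%:E (fun j => sigma j * b j) <= K) ->
  (mixed_norm x0 s%:E q%:E sigma x' x'' <= K%:E)%E.
Proof.
move=> q0 qs K0 h; apply/lee_addgt0Pr => e e0; rewrite -EFinD.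
have s0 : 0 < s by exact: lt_trans qs.
have [qN sN] : q != 0 /\ s != 0 by rewrite !gt_eqF.
have Ke : 0 <= K + e by rewrite addr_ge0 ?(ltW e0).
pose th := q / s.
have th0 : 0 < th by rewrite divr_gt0.
have th1 : th <= 1 by rewrite ler_pdivrMr// mul1r ltW.
pose u := (q^-1 - s^-1)^-1.
have u0 : 0 < u by rewrite invr_gt0 subr_gt0 ltf_pV2.
have uV : u^-1 = q^-1 - s^-1 by rewrite invrK.
have uE : conj_exp s%:E q%:E = u%:E.
  rewrite /conj_exp !inver (negbTE qN) (negbTE sN) -EFinB inver gt_eqF//.
  by rewrite -invr_gt0.
pose Wk (c : 'I_m -> R) := fine (weak_lip_norm x0 s%:E c x' x'').
have WkE c : weak_lip_norm x0 s%:E c x' x'' = (Wk c)%:E /\ 0 <= Wk c.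
  by rewrite /Wk; have [W W0 ->] := weak_real x0 x' x'' c (s0 : (0 < s%:E)%E).
pose G := [set k : 'rV[R]_m | (forall j, 0 <= k ord0 j) /\
  forall c : 'I_m -> R, \sum_j `|c j| `^ s * k ord0 j <= Wk c `^ s].
have Glip f : lip_dual_ball x0 f ->
    G (\row_j `|f (x' j) - f (x'' j)| `^ s).
  move=> Bf; split => [j|c]; first by rewrite mxE powR_ge0.
  have [WE W0] := WkE c.
  have := weak_ub x' x'' s%:E c Bf; rewrite WE lee_fin lnorm_fin_le//.
  apply: le_trans; apply: ler_sum => j _.
  by rewrite mxE -powRM// normrM !normr_id.
have Gdom k : G k -> dom s%:E (fun j => k ord0 j `^ s^-1).
  move=> [k0 kW] c; have [WE W0] := WkE c.
  rewrite WE lee_fin lnorm_fin_le//; apply: le_trans (kW c).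
  apply: ler_sum => j _.
  by rewrite normrM powRM// (ger0_norm (powR_ge0 _ _)) powRVK.
pose B (j : 'I_m) := Wk (fun i => (i == j)%:R) `^ s.
have GB k j : G k -> k ord0 j <= B j.
  move=> [k0 kW]; apply: le_trans (kW _).
  rewrite (bigD1 j)//= eqxx normr1 powR1 mul1r lerDl sumr_ge0// => i _.
  by rewrite mulr_ge0 ?powR_ge0.
have Gsum k : G k -> \sum_j `|sigma j| `^ q * k ord0 j `^ th <= K `^ q.
  move=> Gk; have := h _ (Gdom k Gk); rewrite lnorm_fin_le//.
  apply: le_trans; apply: ler_sum => j _.
  by rewrite normrM powRM// (ger0_norm (powR_ge0 _ _)) -powRrM [s^-1 * q]mulrC.
(* The perturbation by eps costs at most eps ^ th * A, uniformly over G since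
   the coordinates of G are bounded by B. *)
pose A := \sum_j (`|sigma j| `^ q + (B j + 1) `^ th).
have A0 : 0 <= A by rewrite sumr_ge0// => j _; rewrite addr_ge0 ?powR_ge0.
have [eps [eps0 eps1 epsA]] : exists eps, [/\ 0 < eps, eps <= 1 &
    eps `^ th * A <= (K + e) `^ q - K `^ q].
  set d := _ - _; have d0 : 0 < d.
    by rewrite subr_gt0; apply: gt0_ltr_powR; rewrite ?nnegrE// ltrDl.
  have A1 : 0 < A + 1 by rewrite ltr_wpDl.
  pose z := Num.min 1 (d / (A + 1)).
  have z0 : 0 < z by rewrite lt_min ltr01 divr_gt0.
  have z1 : z <= 1 by rewrite ge_min lexx.
  exists (z `^ th^-1); split; first exact: powR_gt0.
    have <- : 1 `^ th^-1 = 1 :> R by rewrite powR1.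
    by apply: ge0_ler_powR; rewrite ?nnegrE ?invr_ge0 ?(ltW z0) ?(ltW th0).
  rewrite powRVK ?(ltW z0) ?gt_eqF//.
  apply: (@le_trans _ _ (d / (A + 1) * A)).
    by rewrite ler_wpM2r// ge_min lexx orbT.
  by rewrite mulrAC ler_pdivrMr// ler_wpM2l ?(ltW d0)// lerDl.
pose a j := `|sigma j| `^ q + eps.
have a0 j : 0 < a j by rewrite ltr_wpDl ?powR_ge0.
have [v Gv vopt] : exists2 v, G v & forall k, G k ->
    \sum_j a j * (v ord0 j + eps) `^ (th - 1) * k ord0 j <=
    \sum_j a j * (v ord0 j + eps) `^ th.
  apply: concave_sum_maximizer => //.
  - by eexists; apply: (Glip _ (dist_in_ball x0 x0)).
  - exact: (halfspaces_compact GB).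
  - by move=> k j [k0 _].
  - exact: halfspaces_convex.
  - by move=> j; exact: ltW.
  - by rewrite th0.
have v0 j : 0 < v ord0 j + eps by rewrite ltr_wpDl// (proj1 Gv).
set M := \sum_j a j * (v ord0 j + eps) `^ th in vopt.
have M0 : 0 <= M by rewrite sumr_ge0// => j _; rewrite mulr_ge0 ?powR_ge0 ?(ltW (a0 _)).
have MK : M <= (K + e) `^ q.
  have : M <= \sum_j `|sigma j| `^ q * v ord0 j `^ th + eps `^ th * A.
    rewrite mulr_sumr -big_split/=; apply: ler_sum => j _.
    have e1 : eps <= eps `^ th by rewrite ger1_powR ?eps0.
    have e2 : (v ord0 j + eps) `^ th <= (B j + 1) `^ th.
      apply: ge0_ler_powR; rewrite ?nnegrE ?(ltW th0) ?(ltW (v0 _))//.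
        by rewrite addr_ge0 ?powR_ge0.
      by rewrite lerD ?GB.
    have e3 : (v ord0 j + eps) `^ th <= v ord0 j `^ th + eps `^ th.
      by apply: powR_subadd; rewrite ?(proj1 Gv) ?(ltW eps0) ?(ltW th0).
    rewrite /a mulrDl mulrDr addrA; apply: lerD.
      by rewrite [eps `^ th * _]mulrC -mulrDr ler_wpM2l ?powR_ge0.
    by apply: ler_pM; rewrite ?powR_ge0 ?(ltW eps0).
  move/le_trans; apply.
  by apply: le_trans (lerD (Gsum v Gv) epsA) _; rewrite addrC subrK.
(* tau has u-norm at most M ^ (1/u), and sigma / tau has weak norm at most
   M ^ (1/s) by optimality; the product is M ^ (1/q). *)
pose tau j := (a j * (v ord0 j + eps) `^ th) `^ u^-1.
have tau0 j : 0 < tau j by rewrite powR_gt0// mulr_gt0 ?powR_gt0.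
apply: (@mixed_le _ _ _ tau) => //; first by rewrite lee_fin ltW.
  by move=> j; rewrite gt_eqF.
move=> f Bf; rewrite uE.
apply: (@le_trans _ _ (M `^ u^-1 * M `^ s^-1)); last first.
  have E : u^-1 + s^-1 = q^-1 by rewrite uV subrK.
  by rewrite -powRD ?E ?invr_eq0 ?(negbTE qN)// ler_powR_root.
apply: ler_pM; rewrite ?lnorm_ge0//.
  rewrite lnorm_fin_le ?powR_ge0// powRVK ?gt_eqF//; apply: ler_sum => j _.
  rewrite ger0_norm ?(ltW (tau0 _))// /tau powRVK ?gt_eqF//.
  by rewrite mulr_ge0 ?powR_ge0 ?(ltW (a0 _)).
rewrite lnorm_fin_le ?powR_ge0// powRVK ?gt_eqF//.
apply: le_trans (vopt _ (Glip f Bf)); apply: ler_sum => j _.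
rewrite mxE normrM !normr_id powRM// ler_wpM2r ?powR_ge0//.
rewrite normrM normfV (gtr0_norm (tau0 j)).
by apply: mixed_weight_le => //; rewrite lerDl ltW.
Qed.

(** The other half of the duality: a bound tested on dominated vectors alone gives
    a bound for the infimum over [tau]. *)
Lemma mixed_le_dominated s q sigma K : (0 < q)%E -> (q <= s)%E -> 0 <= K ->
  (forall b, dom s b -> lnorm q (fun j => sigma j * b j) <= K) ->
  (mixed_norm x0 s q sigma x' x'' <= K%:E)%E.
Proof.
move=> q0; case: s => [s| |]; last by rewrite leeNy_eq => /eqP qE; rewrite qE in q0.
- case: q q0 => [q| |]// q0; rewrite lee_fin le_eqVlt => /predU1P[<- K0|qs K0 h].
    exact: mixed_le_diag.
  exact: mixed_le_fin.
- by move=> _ K0 h; apply: mixed_le_infty => //; apply: h; exact: weakly_dominated_dist.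
Qed.

End Fixed.
End Converse.

(** * Inclusion of the classes of mixed summing maps *)

Local Open Scope ereal_scope.

Theorem proposition4p16 (R : realType) (X Y : metricType R) (x0 : X) (y0 : Y)
    (s1 s2 p1 p2 r1 r2 : \bar R)
    (hs2 : 1 <= s2) (hs : s2 <= s1)
    (hps1 : p1 <= s1) (hps2 : p2 <= s2)
    (hp1 : 0 < p1) (hp : p1 <= p2)
    (hr1 : 0 < r1) (hr : r1 <= r2)
    (hrp1 : r1 <= p1) (hrp2 : r2 <= p2)
    (hrp : r1^-1 - r2^-1 <= p1^-1 - p2^-1) :
  mixed_summing x0 y0 s1 p1 r1 `<=` mixed_summing x0 y0 s2 p2 r2 /\
  (forall S : X -> Y, mixed_summing x0 y0 s1 p1 r1 S ->
    mixed_summing_norm x0 y0 s2 p2 r2 S <= mixed_summing_norm x0 y0 s1 p1 r1 S).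
Proof.
have p20 : 0 < p2 := lt_le_trans hp1 hp.
have s20 : 0 < s2 := lt_le_trans p20 hps2.
have r20 : 0 < r2 := lt_le_trans hr1 hr.
have [t0 tp] := conj_expP hp1 hp.
have key S : mixed_summing_const x0 y0 s1 p1 r1 S `<=`
             mixed_summing_const x0 y0 s2 p2 r2 S.
  move=> C [C0 hC]; split => // m sigma x' x''.
  have [W W0 WE] := weak_real x0 x' x'' sigma r20.
  rewrite WE -EFinM; apply: mixed_le_dominated => //; first exact: mulr_ge0.
  move=> b /(weakly_dominated_le s20 hs) bs1.
  apply: (lnorm_le_dual hp1 t0 p20 (esym tp)) => [|w w1]; first exact: mulr_ge0.
  have := weakly_dominated_mixed (fun j => w j * sigma j)%R hp1 hps1 bs1.
  rewrite -lee_fin; under [X in lnorm _ X]eq_fun do rewrite -mulrA.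
  move=> /le_trans; apply; apply: (le_trans (hC _ _ _ _)).
  rewrite EFinM lee_wpmul2l ?lee_fin//.
  apply: (le_trans (weak_holder _ _ _ _ _ hr1 t0 r20 _)).
    rewrite -leeBlDr; last by rewrite -rec_exp_fineK.
    by apply: (le_trans hrp); rewrite -tp addeK// -rec_exp_fineK.
  by rewrite WE -EFinM lee_fin ler_piMl.
split.
  by move=> S [LS [C hC]]; split => //; exists C; exact: key.
by move=> S _; apply: le_ereal_inf; apply: image_subset; exact: key.
Qed.
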